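(* Let $(X,\langle\cdot,\cdot\rangle)$ be a real Hilbert space. Then for any orthogonal projection $P$ on a closed subspace of $X$, $$2|\langle Px,y\rangle|\le D(x,y|P)+|\langle x,y\rangle|\qquad\text{for all }x,y\in X,$$ or equivalently $$|\langle Px,y\rangle|\le D(P^{\perp}x,y|P)+|\langle x,y\rangle|\qquad\text{for all }x,y\in X.$$
   Context: For an orthogonal projection $P$ on a closed subspace of a real Hilbert space $X$ with norm $\|x\|=\sqrt{\langle x,x\rangle}$, write $P^{\perp}=I-P$ and define, for $x,y\in X$, $$D(x,y|P)=\|Px\|\cdot\|Py\|+\|x-Px\|\cdot\|y-Py\|.$$ *)

(* Defs.v *)
From HB Require Import structures.
From mathcomp Require Import all_boot all_order all_algebra.
From mathcomp Require Import all_classical all_reals all_analysis.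

Set Implicit Arguments.
Unset Strict Implicit.
Unset Printing Implicit Defensive.

Import Order.TTheory GRing.Theory Num.Theory.
Import numFieldNormedType.Exports.

Local Open Scope classical_set_scope.
Local Open Scope ring_scope.

(* A real Hilbert space is a completeNormedModType over a realType together
   with an inner product ({dot X for idfun}: bilinear, symmetric, positive
   definite) that induces the norm. *)
Definition norm_induced_by (R : realType) (X : normedModType R)
    (dot : {dot X for idfun}) : Prop :=
  forall x : X, `|x| = Num.sqrt (dot x x).

Definition closed_subspace (R : realType) (X : normedModType R)
    (M : set X) : Prop :=
  submod_closed (mem M) /\ closed M.

Definition orthogonal_projection_on (R : realType) (X : normedModType R)
    (dot : {dot X for idfun}) (M : set X) (P : X -> X) : Prop :=
  forall x : X, M (P x) /\ (forall m : X, M m -> dot (x - P x) m = 0).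

Definition Pperp (R : realType) (X : normedModType R) (P : X -> X) : X -> X :=
  fun x => x - P x.

Definition D (R : realType) (X : normedModType R) (P : X -> X) (x y : X) : R :=
  `|P x| * `|P y| + `|x - P x| * `|y - P y|.

(* Main.v *)
Require Import Defs.
From HB Require Import structures.
From mathcomp Require Import all_boot all_order all_algebra.
From mathcomp Require Import all_classical all_reals all_analysis.
From mathcomp Require Import ring lra.

Set Implicit Arguments.
Unset Strict Implicit.
Unset Printing Implicit Defensive.

Import Order.TTheory GRing.Theory Num.Theory.
Import numFieldNormedType.Exports.

Local Open Scope classical_set_scope.
Local Open Scope ring_scope.

(** The theorem is an elementary consequence of splitting the inner product
    along the projection.  Since [x - P x] is orthogonal to the range of [P],
    [<x, y> = <P x, P y> + <x - P x, y - P y>], and [<P x, y> = <P x, P y>]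
    ([dot_proj_split], [dot_projl]).  Hence
    [2 <P x, y> = <x, y> + (<P x, P y> - <x - P x, y - P y>)], and bounding the
    two terms of the difference separately by the Cauchy-Schwarz inequality
    ([normr_dot_le]) yields exactly [D P x y]: this is the first inequality.

    For the second one, [P] kills [x - P x] ([proj_perp]), so
    [D P (x - P x) y] reduces to [`|x - P x| * `|y - P y|], and the bound is
    the Cauchy-Schwarz inequality applied to
    [<P x, y> = <x, y> - <x - P x, y - P y>]. *)

Section InnerProduct.

Variables (R : realType) (X : normedModType R) (dot : {dot X for idfun}).
Hypothesis norm_dot : norm_induced_by dot.

Lemma dotC x y : dot x y = dot y x.
Proof. by rewrite (hermC dot) expr0 mul1r. Qed.

Lemma dot_ge0 x : 0 <= dot x x.
Proof.
have [->|x0] := eqVneq x 0; first by rewrite linear0l.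
exact/ltW/neq0_dnorm_gt0.
Qed.

Lemma dotxx x : dot x x = `|x| ^+ 2.
Proof. by rewrite norm_dot sqr_sqrtr// dot_ge0. Qed.

(** Expanding [`| `|y| x - `|x| y |^2 >= 0] gives
    [`|x| `|y| <x, y> <= (`|x| `|y|)^2]; one divides by [`|x| `|y|], the
    inequality being trivial when this product vanishes. *)
Lemma dot_le_norm x y : dot x y <= `|x| * `|y|.
Proof.
have [->|x0] := eqVneq x 0; first by rewrite linear0l normr0 mul0r.
have [->|y0] := eqVneq y 0; first by rewrite linear0r normr0 mulr0.
have xy0 : 0 < `|x| * `|y| by rewrite mulr_gt0 ?normr_gt0.
have := dot_ge0 (`|y| *: x - `|x| *: y).
rewrite linearBl !linearBr !linearZl_LR !linearZr_LR /=.
rewrite !dotxx (dotC y x) /GRing.scale /= => h.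
by rewrite -(ler_pM2l xy0); lra.
Qed.

Lemma normr_dot_le x y : `|dot x y| <= `|x| * `|y|.
Proof.
rewrite ler_norml dot_le_norm andbT lerNl -linearNl -(normrN x).
exact: dot_le_norm.
Qed.

Variables (M : set X) (P : X -> X).
Hypothesis projP : orthogonal_projection_on dot M P.

Lemma dot_perp_proj x y : dot (x - P x) (P y) = 0.
Proof. by have [_ ->] := projP x; have [] := projP y. Qed.

Lemma dot_projl x y : dot (P x) y = dot (P x) (P y).
Proof.
by have /eqP := dot_perp_proj y x; rewrite dotC linearBr subr_eq0 => /eqP.
Qed.

Lemma dot_proj_split x y :
  dot x y = dot (P x) (P y) + dot (x - P x) (y - P y).
Proof.
rewrite linearBr /= dot_perp_proj subr0 linearBl /= (dot_projl x y).
by rewrite addrC subrK.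
Qed.

(** [P (x - P x)] lies in [M], so it is orthogonal both to [x - P x] and to
    [(x - P x) - P (x - P x)]; hence it is orthogonal to itself. *)
Lemma proj_perp x : P (x - P x) = 0.
Proof.
have := dot_perp_proj (x - P x) (x - P x).
rewrite linearBl /= dot_perp_proj sub0r => /eqP.
by rewrite oppr_eq0 dotxx sqrf_eq0 normr_eq0 => /eqP.
Qed.

End InnerProduct.

Theorem corollary2p1 (R : realType) (X : completeNormedModType R)
    (dot : {dot X for idfun}) (hdot : norm_induced_by dot)
    (M : set X) (hM : closed_subspace M)
    (P : X -> X) (hP : orthogonal_projection_on dot M P) :
  (forall x y : X, 2 * `|dot (P x) y| <= D P x y + `|dot x y|) /\
  (forall x y : X, `|dot (P x) y| <= D P (Pperp P x) y + `|dot x y|).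
Proof.
split=> x y.
  rewrite (dot_projl hP) (dot_proj_split hP x y) /D.
  have := normr_dot_le hdot (P x) (P y).
  have := normr_dot_le hdot (x - P x) (y - P y).
  set a := dot (P x) (P y); set b := dot (x - P x) (y - P y) => hb ha.
  have -> : 2 * `|a| = `|(a + b) + (a - b)|.
    by rewrite -(normr_nat R 2) -normrM; congr `|_|; ring.
  rewrite [leRHS]addrC (le_trans (ler_normD _ _))// lerD2l.
  by rewrite (le_trans (ler_normB _ _))// lerD.
rewrite /D /Pperp (proj_perp hdot hP) normr0 mul0r add0r subr0.
rewrite (dot_projl hP) -[dot (P x) (P y)](addrK (dot (x - P x) (y - P y))).
rewrite -(dot_proj_split hP) addrC.
by rewrite (le_trans (ler_normD _ _))// normrN lerD// normr_dot_le.
Qed.
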